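(* Let $G$ be a group, $(H,\mathcal{E}_{\mathcal{I}})$ a coarse group, where $\mathcal{I}$ is a group ideal on $H$, and let $f,g\colon G\to H$ be two maps. Suppose that $f\sim_M g$ for some $M\in\mathcal{I}$. If $M^H\in\mathcal{I}$, then $f$ is a quasi-homomorphism if and only if $g$ is a quasi-homomorphism.
   Context: A group ideal $\mathcal{I}$ on a group $H$ is a family of subsets of $H$ containing $\{e\}$ and closed under subsets, finite unions, products $KJ=\{kj\mid k\in K, j\in J\}$ and inverses $K^{-1}=\{k^{-1}\mid k\in K\}$. For $K\in\mathcal{I}$ put $E_K=\{(h,hk)\mid h\in H,\,k\in K\}$. The coarse group $(H,\mathcal{E}_{\mathcal{I}})$ is $H$ endowed with the (left) coarse structure $\mathcal{E}_{\mathcal{I}}=\{E\subseteq H\times H\mid \exists K\in\mathcal{I}:\ E\subseteq E_K\}$. For $M\subseteq H$, $M^H=\bigcup_{h\in H}h^{-1}Mh$. For maps $f,g$ from a set $S$ to $H$ and $M\in\mathcal{I}$, $f\sim_M g$ means that $g(x)\in f(x)M$ for every $x\in S$. A map $f\colon G\to(H,\mathcal{E}_{\mathcal{I}})$ is a quasi-homomorphism if there exists $K\in\mathcal{I}$ such that $f(xy)\in f(x)f(y)K$ for all $x,y\in G$. *)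

(* Defs.v *)
From mathcomp Require Import all_boot all_fingroup.
From mathcomp Require Import boolp classical_sets.

Set Implicit Arguments.
Unset Strict Implicit.
Unset Printing Implicit Defensive.

Local Open Scope classical_set_scope.
Local Open Scope group_scope.

Definition setprod (H : groupType) (K J : set H) : set H :=
  [set k * j | k in K & j in J].

Definition setinv (H : groupType) (K : set H) : set H :=
  [set k^-1 | k in K].

(* The empty union needs no clause: set0 is in I as a subset of [set 1]. *)
Record group_ideal (H : groupType) (I : set (set H)) : Prop := GroupIdeal {
  group_ideal1 : I [set 1];
  group_idealS : forall K J : set H, J `<=` K -> I K -> I J;
  group_idealU : forall K J : set H, I K -> I J -> I (K `|` J);
  group_idealM : forall K J : set H, I K -> I J -> I (setprod K J);
  group_idealV : forall K : set H, I K -> I (setinv K) }.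

Definition entourage_of (H : groupType) (K : set H) : set (H * H) :=
  [set (h, h * k) | h in [set: H] & k in K].

(* The coarse group attached to I is H with this left coarse structure. It is
   determined by I, and the notions below refer to it through I. *)
Definition coarse_structure (H : groupType) (I : set (set H)) :
    set (set (H * H)) :=
  [set E | exists2 K, I K & E `<=` entourage_of K].

Definition conj_closure (H : groupType) (M : set H) : set H :=
  \bigcup_(h : H) [set h^-1 * m * h | m in M].

Definition close_by (S : Type) (H : groupType) (M : set H) (f g : S -> H) :
    Prop :=
  forall x : S, [set f x * m | m in M] (g x).

Definition quasi_homomorphism (G H : groupType) (I : set (set H))
    (f : G -> H) : Prop :=
  exists2 K, I K & forall x y : G, [set f x * f y * k | k in K] (f (x * y)).

(* Main.v *)
Require Import Defs.
From mathcomp Require Import all_boot all_fingroup.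
From mathcomp Require Import boolp classical_sets.

(** Write [g z = f z * m z] with [m z] in [M]. If [f (x * y) = f x * f y * k],
    substituting gives
      [g (x * y) = g x * (m x)^-1 * g y * (m y)^-1 * k * m (x * y)],
    and the only obstacle to reading off an error term on the right is the
    factor [(m x)^-1], which is trapped to the left of [g y]. Moving it past
    [g y] replaces it by its conjugate by [g y]; as [g y] is arbitrary, this
    stays in a member of the ideal because all conjugates of [M] lie together in
    one. The error of [g] is then controlled by the product of the inverse of
    [conj_closure M], [M^-1], [K] and [M], where [K] bounds the error of [f]
    ([quasi_homomorphism_close]).
    Closeness is symmetric up to replacing [M] by [M^-1], and conjugation
    commutes with inversion, so the converse is the same implication. *)

Local Open Scope classical_set_scope.
Local Open Scope group_scope.

Lemma mem_setprod (H : groupType) (K J : set H) (k j : H) :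
  K k -> J j -> setprod K J (k * j).
Proof. by move=> Kk Jj; exists k => //; exists j. Qed.

Lemma close_by_sym (S : Type) (H : groupType) (M : set H) (f g : S -> H) :
  close_by M f g -> close_by (setinv M) g f.
Proof.
move=> fg x; have [m Mm gx] := fg x.
by exists m^-1; [exists m | rewrite -gx mulgK].
Qed.

(** This is what lets the hypothesis on the conjugates of [M] pass to [M^-1]
    when the roles of the two maps are exchanged. *)
Lemma conj_closure_setinv (H : groupType) (M : set H) :
  conj_closure (setinv M) `<=` setinv (conj_closure M).
Proof.
move=> _ [h _ [_ [m Mm <-] <-]].
exists (h^-1 * m * h); first by exists h => //; exists m.
by rewrite !invMg invgK mulgA.
Qed.

(** The four factors of the bound are, in order, the inverse displacement at [x]
    conjugated by [g y], the inverse displacement at [y], the error of [f], and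
    the displacement at [x * y]. *)
Lemma quasi_homomorphism_close (G H : groupType) (I : set (set H))
    (f g : G -> H) (M : set H) :
  group_ideal I -> I M -> close_by M f g -> I (conj_closure M) ->
  quasi_homomorphism I f -> quasi_homomorphism I g.
Proof.
move=> idI IM fg IMH [K IK fK].
exists (setprod (setprod (setinv (conj_closure M)) (setinv M)) (setprod K M)).
  by do ![apply: (group_idealM idI) | apply: (group_idealV idI)].
move=> x y; have [a Ma gx] := fg x; have [b Mb gy] := fg y.
have [c Mc gxy] := fg (x * y); have [k Kk fxy] := fK x y.
(* The leftmost factor is [a^-1] after it has been moved past [g y]. *)
exists (((g y)^-1 * a * g y)^-1 * b^-1 * (k * c)).
  apply: mem_setprod; apply: mem_setprod => //; last by exists b.
  by exists ((g y)^-1 * a * g y) => //; exists (g y) => //; exists a.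
by rewrite -gxy -fxy -gx !invMg !invgK !mulgA !mulgK -gy !mulgA mulgK.
Qed.

Theorem proposition4p6 (G H : groupType) (I : set (set H)) (f g : G -> H)
    (M : set H) :
  group_ideal I -> I M -> close_by M f g -> I (conj_closure M) ->
  quasi_homomorphism I f <-> quasi_homomorphism I g.
Proof.
move=> idI IM fg IMH; split; first exact: quasi_homomorphism_close IMH.
apply: (@quasi_homomorphism_close _ _ _ _ _ (setinv M)) => //.
- exact: (group_idealV idI).
- exact: close_by_sym.
- apply: (group_idealS idI (@conj_closure_setinv H M)).
  exact: (group_idealV idI).
Qed.
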